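(* Let $T^*:=\frac1\mu\ln M$. Assume that $T_{2n}=T^0$ for all $n\in\mathbb N$, with $T^0>T^*$; that $T_{2n+1}=\tilde T$ for all $n\in\mathbb N$; and that $$\sup_{n\in\mathbb N}\ e^{2D_{2n+1}\tilde T}c=d<1,$$ where $c=Me^{-\mu T^0}$. Then there exist two positive constants $C,\alpha$ such that $$\|U(t)\|\le Ce^{-\alpha t}\|U_0\|,\qquad t>0,$$ for any solution $U$ of the problem $U_t(t)=\mathcal A U(t)+\mathcal B(t)U(t)$, $t>0$, $U(0)=U_0$ (with $U_0\in\mathcal H$ arbitrary).
   Context: $\mathcal H$ is a Hilbert space with norm $\|\cdot\|$ and inner product $\langle\cdot,\cdot\rangle$, and $\mathcal L(\mathcal H)$ is the space of bounded linear operators from $\mathcal H$ to itself. $\mathcal A$ is a dissipative (in general unbounded) linear operator in $\mathcal H$ generating a $C_0$-semigroup $(S(t))_{t\ge 0}$, and $M,\mu>0$ are constants with $\|S(t)\|_{\mathcal L(\mathcal H)}\le Me^{-\mu t}$ for all $t\ge 0$. $\mathbb N=\{0,1,2,\dots\}$. There is a strictly increasing sequence of real numbers $(t_n)_{n\in\mathbb N}$ with $t_0=0$; put $I_n=[t_n,t_{n+1})$ and $T_n=t_{n+1}-t_n$. For each $n\in\mathbb N$, $\mathcal B(t)=0$ for $t\in I_{2n}$ and $\mathcal B(t)=\mathcal D_{2n+1}$ for $t\in I_{2n+1}$, where $\mathcal D_{2n+1}\in\mathcal L(\mathcal H)$ is a fixed operator; $D_{2n+1}:=\|\mathcal D_{2n+1}\|_{\mathcal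 L(\mathcal H)}$. The operators satisfy $\langle\mathcal B(t)V,V\rangle\ge0$ for all $V\in\mathcal H$ and $t>0$ (anti-damping). A solution means a mild solution: a function $U\in C([0,\infty);\mathcal H)$ satisfying $U(t)=S(t)U_0+\int_0^tS(t-s)\mathcal B(s)U(s)\,ds$ for all $t\ge0$. *)

(* Defs.v *)
From Stdlib Require Import Reals.
From Coquelicot Require Import Coquelicot.

Open Scope R_scope.

(** Real Hilbert spaces.  A complex Hilbert space is one for the real part of
    its inner product, with the same norm. *)
Record Hilbert := {
  hilbert_space :> CompleteNormedModule R_AbsRing;
  inner : hilbert_space -> hilbert_space -> R;
  inner_sym : forall x y, inner x y = inner y x;
  inner_plus_l : forall x y z, inner (plus x y) z = inner x z + inner y z;
  inner_scal_l : forall (a : R) x y, inner (scal a x) y = a * inner x y;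
  inner_ge_0 : forall x, 0 <= inner x x;
  inner_eq_0 : forall x, inner x x = 0 -> x = zero;
  norm_inner : forall x : hilbert_space, norm x = sqrt (inner x x)
}.

Arguments inner {_} _ _.

(** Coquelicot's [is_linear] includes boundedness, so [is_linear f] says that
    [f] belongs to L(H).  The supremum is finite, hence meaningful as a real
    number, for such [f]. *)
Definition op_norm {H : Hilbert} (f : H -> H) : R :=
  real (Lub_Rbar (fun r => exists x : H, norm x <= 1 /\ r = norm (f x))).

(** Possibly unbounded operators: [op_fun] is irrelevant outside [op_dom]. *)
Record LinearOperator (H : Hilbert) := {
  op_dom : H -> Prop;
  op_fun :> H -> H;
  op_dom_zero : op_dom zero;
  op_dom_plus : forall x y, op_dom x -> op_dom y -> op_dom (plus x y);
  op_dom_scal : forall (a : R) x, op_dom x -> op_dom (scal a x);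
  op_fun_plus : forall x y, op_dom x -> op_dom y ->
    op_fun (plus x y) = plus (op_fun x) (op_fun y);
  op_fun_scal : forall (a : R) x, op_dom x ->
    op_fun (scal a x) = scal a (op_fun x)
}.

Arguments op_dom {_} _ _.
Arguments op_fun {_} _ _.

Definition dissipative {H : Hilbert} (A : LinearOperator H) : Prop :=
  forall x, op_dom A x -> inner (A x) x <= 0.

(** Only the values [S t] with [0 <= t] matter. *)
Record is_C0_semigroup {H : Hilbert} (S : R -> H -> H) : Prop := {
  semigroup_linear : forall t, 0 <= t -> is_linear (S t);
  semigroup_0 : forall x, S 0 x = x;
  semigroup_plus : forall s t x, 0 <= s -> 0 <= t -> S (s + t) x = S s (S t x);
  semigroup_cont : forall x,
    filterlim (fun t => S t x) (at_right 0) (locally x)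
}.

Definition generates {H : Hilbert} (A : LinearOperator H) (S : R -> H -> H) :
    Prop :=
  is_C0_semigroup S /\
  forall x y : H,
    (op_dom A x /\ A x = y) <->
    filterlim (fun h => scal (/ h) (minus (S h x) x)) (at_right 0) (locally y).

(** The Riemann integral is enough for piecewise continuous integrands, and
    [s => S (t - s) (B s (U s))] is one when [U] is continuous and [B] is
    piecewise constant, with finitely many pieces on [0, t], as in the
    intermittent case; its existence is then automatic. *)
Definition mild_solution {H : Hilbert} (S B : R -> H -> H) (U0 : H)
    (U : R -> H) : Prop :=
  continuous_on (fun t => 0 <= t) U /\
  forall t, 0 <= t ->
    exists I : H,
      is_RInt (fun s => S (t - s) (B s (U s))) 0 t I /\
      U t = plus (S t U0) I.

(* Main.v *)
Require Import Defs.
From Stdlib Require Import Reals Lra Lia.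
From Coquelicot Require Import Coquelicot.
Open Scope R_scope.

(** The proof bounds a mild solution separately on the two kinds of intervals.

    A mild solution can be restarted at any time [r]: applying [S (s - r)] to
    the variation of constants formula at [r] and subtracting it from the one
    at [s] leaves the same formula with initial time [r] and initial datum
    [U r] ([mild_solution_restart]).  While [B] vanishes, [U] therefore follows
    the semigroup, and a whole interval of this kind multiplies the norm by at
    most [c = M * exp (- mu * T0)].  On an interval where [B] equals an
    operator of norm [k], Gronwall's inequality multiplies the norm by at most
    [exp (k * Tt)] ([mild_solution_growth]).  One period thus multiplies the
    norm by at most [exp (k * Tt) * c <= exp (2 * k * Tt) * c <= d < 1], and a
    geometric sequence sampled at equidistant times is an exponential
    ([geometric_le_exponential]).  Inside the last, incomplete period the norm
    grows by at most [exp (k * Tt) <= d / c], uniformly in the period.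

    The Gronwall step needs [norm (S s x) <= norm x]: with the bound
    [M * exp (- mu * s)] alone, the constant [M], possibly greater than 1,
    would enter at each period and in the exponent.  The contraction property
    is where dissipativity is used ([dissipative_semigroup_contraction]).  For
    [x] in the domain of the generator, [z = S (r + h) x] is up to [o(h)] the
    implicit Euler step from [S r x], namely [z - h A z = S r x + o(h)], and
    dissipativity gives [norm z <= norm (z - h A z)].  The error is
    [S r] applied to a vector independent of [r], hence uniform in [r], so
    summing over [s / h] steps and letting [h] tend to 0 gives the contraction
    on the domain; the domain is dense ([generator_domain_dense]). *)

(** * Normed spaces and operator norms *)

Lemma norm_scal_le {V : NormedModule R_AbsRing} (a : R) (x : V) :
  0 <= a -> norm (scal a x) <= a * norm x.
Proof.
  intros Ha. rewrite <- (Rabs_pos_eq a Ha) at 2. exact (norm_scal a x).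
Qed.

Lemma plus_minus_cancel {G : AbelianGroup} (x y : G) : plus y (minus x y) = x.
Proof.
  unfold minus. rewrite plus_assoc, (plus_comm y x), <- plus_assoc, plus_opp_r.
  apply plus_zero_r.
Qed.

Lemma plus_minus_minus {G : AbelianGroup} (x y z : G) :
  plus x (minus (minus y x) z) = minus y z.
Proof.
  unfold minus at 1. rewrite plus_assoc, plus_minus_cancel. reflexivity.
Qed.

Lemma minus_plus_cancel {G : AbelianGroup} (x y : G) : minus (plus x y) x = y.
Proof.
  change (plus (plus x y) (opp x) = y).
  rewrite (plus_comm x y), <- plus_assoc, plus_opp_r. apply plus_zero_r.
Qed.

Lemma minus_minus_comm {G : AbelianGroup} (x y z : G) :
  minus (minus x y) z = minus (minus x z) y.
Proof.
  unfold minus. rewrite <- plus_assoc, (plus_comm (opp y)), plus_assoc. reflexivity.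
Qed.

Lemma norm_le_plus_minus {V : NormedModule R_AbsRing} (x y : V) :
  norm x <= norm y + norm (minus x y).
Proof.
  rewrite <- (plus_minus_cancel x y) at 1. apply norm_triangle.
Qed.

Lemma norm_minus_sym {V : NormedModule R_AbsRing} (x y : V) :
  norm (minus x y) = norm (minus y x).
Proof. rewrite <- norm_opp, opp_minus. reflexivity. Qed.

Lemma norm_minus_triangle {V : NormedModule R_AbsRing} (x y z : V) :
  norm (minus x y) <= norm (minus x z) + norm (minus y z).
Proof.
  rewrite (minus_trans z x y), (norm_minus_sym y z). apply norm_triangle.
Qed.

Lemma scal_inv_scal {V : ModuleSpace R_Ring} (k : R) (x : V) :
  k <> 0 -> scal (/ k) (scal k x) = x.
Proof.
  intros Hk. rewrite scal_assoc. change (mult (/ k) k) with (/ k * k).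
  rewrite Rinv_l by exact Hk. exact (scal_one x).
Qed.

Lemma scal_minus_scal_inv {V : ModuleSpace R_Ring} (k : R) (x y : V) :
  k <> 0 -> scal k (minus (scal (/ k) x) y) = minus x (scal k y).
Proof.
  intros Hk. eapply eq_trans; [exact (scal_minus_distr_l k (scal (/ k) x) y)|].
  f_equal. rewrite <- (Rinv_inv k) at 1. apply scal_inv_scal.
  now apply Rinv_neq_0_compat.
Qed.

(** Linearity, which includes boundedness, makes the extended supremum in
    [op_norm] finite, so that taking its real part loses nothing. *)
Lemma op_norm_is_lub {H : Hilbert} (f : H -> H) :
  is_linear f ->
  is_lub (fun r => exists x : H, norm x <= 1 /\ r = norm (f x)) (op_norm f).
Proof.
  intros Hf. unfold op_norm.
  set (E := fun r => exists x : H, norm x <= 1 /\ r = norm (f x)).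
  destruct (Lub_Rbar_correct E) as [Hub Hleast].
  destruct (linear_norm f Hf) as [K [HK Hbound]].
  assert (HKub : is_ub_Rbar E K).
  { intros r [x [Hx ->]]. simpl. specialize (Hbound x).
    assert (K * norm x <= K * 1) by (apply Rmult_le_compat_l; lra). lra. }
  assert (Hzero : E (norm (f zero))).
  { exists zero. split; [|reflexivity].
    apply Rle_trans with 0; [right; apply (norm_zero (V := H))|lra]. }
  pose proof (Hub _ Hzero) as H0. pose proof (Hleast K HKub) as HK'.
  destruct (Lub_Rbar E) as [r| |]; simpl in *; try contradiction.
  split.
  - exact Hub.
  - intros b Hb. apply (Hleast b). exact Hb.
Qed.

Lemma op_norm_ge_0 {H : Hilbert} (f : H -> H) : is_linear f -> 0 <= op_norm f.
Proof.
  intros Hf. apply Rle_trans with (norm (f zero)); [apply (norm_ge_0 (V := H))|].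
  apply (op_norm_is_lub f Hf). exists zero. split; [|reflexivity].
  apply Rle_trans with 0; [right; apply (norm_zero (V := H))|lra].
Qed.

Lemma norm_le_op_norm {H : Hilbert} (f : H -> H) (x : H) :
  is_linear f -> norm (f x) <= op_norm f * norm x.
Proof.
  intros Hf. destruct (Req_dec (norm x) 0) as [Hx|Hx].
  - rewrite Hx, Rmult_0_r. apply norm_eq_zero in Hx. subst x.
    right. eapply eq_trans; [apply f_equal, (linear_zero f Hf)|].
    apply (norm_zero (V := H)).
  - assert (Hpos : 0 < norm x) by (pose proof (norm_ge_0 (V := H) x); lra).
    set (y := scal (/ norm x) x : H).
    assert (Hy : norm (f y) <= op_norm f).
    { apply (op_norm_is_lub f Hf). exists y. split; [|reflexivity].
      apply Rle_trans with (/ norm x * norm x).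
      - apply (norm_scal_le (V := H)). left. now apply Rinv_0_lt_compat.
      - right. field. exact Hx. }
    assert (Hxy : x = scal (norm x) y).
    { unfold y. rewrite <- (Rinv_inv (norm x)) at 1. symmetry.
      apply scal_inv_scal. now apply Rinv_neq_0_compat. }
    rewrite Hxy at 1. rewrite (linear_scal f Hf).
    eapply Rle_trans; [apply (norm_scal_le (V := H)); lra|].
    rewrite (Rmult_comm (op_norm f)). apply Rmult_le_compat_l; lra.
Qed.

(** * One-sided limits, integrals and Gronwall's inequality *)

Lemma filterlim_at_right_0_norm {V : NormedModule R_AbsRing} (f : R -> V) (l : V) :
  filterlim f (at_right 0) (locally l) <->
  forall eps, 0 < eps -> exists delta, 0 < delta /\
    forall h, 0 < h < delta -> norm (minus (f h) l) < eps.
Proof.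
  rewrite (filterlim_locally_ball_norm f l). split.
  - intros Hf eps Heps. destruct (Hf (mkposreal eps Heps)) as [delta Hdelta].
    exists delta. split; [apply cond_pos|]. intros h Hh. apply Hdelta; [|lra].
    change (Rabs (h - 0) < delta). rewrite Rabs_pos_eq; lra.
  - intros Hf eps. destruct (Hf eps (cond_pos eps)) as [delta [Hdelta Hlim]].
    exists (mkposreal delta Hdelta). intros h Hball Hh. apply Hlim.
    change (Rabs (h - 0) < delta) in Hball. rewrite Rabs_pos_eq in Hball; lra.
Qed.

Lemma filterlim_minus {T : Type} {F : (T -> Prop) -> Prop} {FF : Filter F}
    {V : NormedModule R_AbsRing} (f g : T -> V) (lf lg : V) :
  filterlim f F (locally lf) -> filterlim g F (locally lg) ->
  filterlim (fun x => minus (f x) (g x)) F (locally (minus lf lg)).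
Proof.
  intros Hf Hg. unfold minus.
  eapply filterlim_comp_2; [exact Hf| |apply filterlim_plus].
  exact (filterlim_comp _ _ _ g opp _ _ _ Hg (filterlim_opp lg)).
Qed.

(** Turns continuity on the closed half line into continuity at every real
    number, so that the integration lemmas apply up to the endpoint 0. *)
Lemma continuous_on_half_line_extension {V : UniformSpace} (f : R -> V) :
  continuous_on (fun s => 0 <= s) f ->
  forall s, continuous (fun r => f (Rmax 0 r)) s.
Proof.
  intros Hf s. unfold continuous.
  eapply filterlim_comp; [|apply Hf, Rmax_l].
  intros P [eps HP]. exists eps. intros r Hr. apply (HP (Rmax 0 r)); [|apply Rmax_l].
  change (Rabs (r - s) < eps) in Hr.
  change (Rabs (Rmax 0 r - Rmax 0 s) < eps).
  unfold Rmax, Rabs in *.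
  destruct (Rle_dec 0 r), (Rle_dec 0 s), (Rcase_abs (r - s));
    try match goal with |- context [Rcase_abs ?z] => destruct (Rcase_abs z) end;
    lra.
Qed.

Lemma filterlim_right_quotient {V : NormedModule R_AbsRing} (G : R -> V)
    (a : R) (l : V) :
  is_derive G a l ->
  filterlim (fun k => scal (/ k) (minus (G (a + k)) (G a))) (at_right 0)
    (locally l).
Proof.
  intros [_ HG]. apply filterlim_at_right_0_norm. intros eps Heps.
  assert (Heps2 : 0 < eps / 2) by lra.
  destruct (HG a (fun P HP => HP) (mkposreal _ Heps2)) as [delta Hdelta].
  exists delta. split; [apply cond_pos|]. intros k Hk.
  assert (Hball : ball a delta (a + k)).
  { change (Rabs (a + k - a) < delta). rewrite Rabs_pos_eq; lra. }
  assert (Hdom : norm (minus (minus (G (a + k)) (G a)) (scal (a + k - a) l))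
    <= eps / 2 * Rabs (a + k - a)) by exact (Hdelta _ Hball).
  replace (a + k - a) with k in Hdom by ring.
  rewrite (Rabs_pos_eq k) in Hdom by lra.
  assert (Hq : minus (scal (/ k) (minus (G (a + k)) (G a))) l =
    scal (/ k) (minus (minus (G (a + k)) (G a)) (scal k l))).
  { rewrite <- (scal_minus_scal_inv (V := V)) by lra.
    symmetry. apply (scal_inv_scal (V := V)). lra. }
  eapply Rle_lt_trans; [right; exact (f_equal norm Hq)|].
  assert (Hk' : 0 < / k) by (apply Rinv_0_lt_compat; lra).
  eapply Rle_lt_trans; [apply norm_scal_le; lra|].
  apply Rle_lt_trans with (/ k * (eps / 2 * k)).
  - apply Rmult_le_compat_l; lra.
  - replace (/ k * (eps / 2 * k)) with (eps / 2) by (field; lra). lra.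
Qed.

(** The Riemann sums commute with [L], and [L] is continuous. *)
Lemma is_RInt_linear {U V : NormedModule R_AbsRing} (L : U -> V) (f : R -> U)
    (a b : R) (I : U) :
  is_linear L -> is_RInt f a b I -> is_RInt (fun s => L (f s)) a b (L I).
Proof.
  intros HL HI. unfold is_RInt in *.
  apply filterlim_ext with
    (fun ptd => L (scal (sign (b - a)) (Riemann_sum f ptd))).
  - intros ptd. rewrite (linear_scal L HL). f_equal.
    apply (SF_cons_ind (T := R)) with
      (P := fun ptd => L (Riemann_sum f ptd) = Riemann_sum (fun s => L (f s)) ptd).
    + intros x. exact (linear_zero L HL).
    + intros h p IH. rewrite !Riemann_sum_cons, (linear_plus L HL).
      rewrite IH. f_equal. apply (linear_scal L HL).
  - eapply filterlim_comp; [exact HI|]. now apply linear_cont.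
Qed.

(** The right-hand side of the hypothesis, times [exp (- k * (s - a))], has a
    nonpositive derivative and starts at [c]. *)
Lemma gronwall (phi : R -> R) (a b c k : R) :
  0 <= k -> (forall s, continuous phi s) ->
  (forall s, a <= s <= b -> phi s <= c + k * RInt phi a s) ->
  forall s, a <= s <= b -> phi s <= c * exp (k * (s - a)).
Proof.
  intros Hk Hphi Hle s Hs.
  set (psi := fun s => (c + k * RInt phi a s) * exp (- k * (s - a))).
  set (dpsi := fun s => (k * phi s - k * (c + k * RInt phi a s)) * exp (- k * (s - a))).
  assert (Hd : forall r, is_derive psi r (dpsi r)).
  { intros r.
    unfold psi, dpsi. auto_derive.
    - split; [|split; [|easy]].
      + apply (ex_RInt_continuous (V := R_CompleteNormedModule)). intros; apply Hphi.
      + apply filter_forall. intros u. apply continuity_pt_filterlim, Hphi.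
    - replace (r + - a) with (r - a) by ring.
      change (RInt (fun x => phi x) a r) with (RInt phi a r). ring. }
  assert (Hdec : psi s <= psi a).
  { destruct (MVT_gen psi a s dpsi) as [r [Hr Heq]].
    - intros; apply Hd.
    - intros r _. apply continuity_pt_filterlim.
      apply (ex_derive_continuous psi). eexists. apply Hd.
    - rewrite Rmin_left, Rmax_right in Hr by lra.
      assert (dpsi r <= 0).
      { unfold dpsi. pose proof (Hle r ltac:(lra)) as Hr'.
        pose proof (exp_pos (- k * (r - a))).
        assert (k * phi r <= k * (c + k * RInt phi a r))
          by now apply Rmult_le_compat_l.
        assert (0 <= - (k * phi r - k * (c + k * RInt phi a r)) * exp (- k * (r - a)))
          by (apply Rmult_le_pos; lra).
        lra. }
      assert (0 <= - dpsi r * (s - a)) by (apply Rmult_le_pos; lra).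
      lra. }
  unfold psi in Hdec. rewrite RInt_point in Hdec.
  change (zero : R) with 0 in Hdec.
  replace (- k * (a - a)) with 0 in Hdec by ring. rewrite exp_0 in Hdec.
  eapply Rle_trans; [now apply Hle|].
  replace (c + k * RInt phi a s) with
    ((c + k * RInt phi a s) * exp (- k * (s - a)) * exp (k * (s - a))).
  - apply Rmult_le_compat_r; [left; apply exp_pos|]. lra.
  - rewrite Rmult_assoc, <- exp_plus.
    replace (- k * (s - a) + k * (s - a)) with 0 by ring. rewrite exp_0. ring.
Qed.

(** * Semigroups generated by dissipative operators *)

Lemma inner_minus_l {H : Hilbert} (x y z : H) :
  inner (minus x y) z = inner x z - inner y z.
Proof.
  assert (Hopp : inner (opp y) z = - inner y z).
  { replace (opp y) with (scal (-1) y : H).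
    - rewrite inner_scal_l. ring.
    - exact (scal_opp_one (V := H) y). }
  eapply eq_trans; [exact (inner_plus_l H x (opp y) z)|]. rewrite Hopp. ring.
Qed.

(** Dissipativity of an operator [A], with [w = A z], makes the resolvent
    [(1 - h A)^-1] nonexpansive. *)
Lemma norm_le_minus_scal {H : Hilbert} (h : R) (z w : H) :
  0 <= h -> inner w z <= 0 -> norm z <= norm (minus z (scal h w)).
Proof.
  intros Hh Hwz. rewrite !norm_inner. apply sqrt_le_1_alt.
  rewrite inner_minus_l, inner_scal_l.
  rewrite (inner_sym _ z (minus z (scal h w))), (inner_sym _ w (minus z (scal h w))).
  rewrite !inner_minus_l, !inner_scal_l, (inner_sym _ z w).
  pose proof (inner_ge_0 H w).
  assert (0 <= h * - inner w z) by (apply Rmult_le_pos; lra).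
  assert (0 <= h * (h * inner w w)) by (apply Rmult_le_pos; [|apply Rmult_le_pos]; lra).
  lra.
Qed.

(** Since [S v x - S u x = S u (S (v - u) x - x)], right continuity at 0 and
    the uniform bound give a modulus of continuity valid on both sides. *)
Lemma semigroup_continuous_on {H : Hilbert} (S : R -> H -> H) (K : R) :
  is_C0_semigroup S -> 0 < K ->
  (forall s x, 0 <= s -> norm (S s x) <= K * norm x) ->
  forall x, continuous_on (fun s => 0 <= s) (fun s => S s x).
Proof.
  intros HS HK Hbound x s Hs.
  apply (filterlim_locally_ball_norm (U := H)). intros eps.
  assert (HepsK : 0 < eps / K) by (apply Rdiv_lt_0_compat; [apply cond_pos|lra]).
  destruct (proj1 (filterlim_at_right_0_norm (V := H) _ _) (semigroup_cont S HS x)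
    _ HepsK) as [delta [Hdelta Hlim]].
  assert (Hmod : forall u v, 0 <= u <= v -> v - u < delta ->
    norm (minus (S v x) (S u x)) < eps).
  { intros u v Huv Hv. destruct (Req_dec u v) as [->|Hne].
    - eapply Rle_lt_trans; [right|apply (cond_pos eps)].
      eapply eq_trans; [apply f_equal, (minus_eq_zero (G := H))|]. apply (norm_zero (V := H)).
    - replace v with (u + (v - u)) by ring.
      rewrite (semigroup_plus S HS u (v - u)) by lra.
      assert (Hlin := semigroup_linear S HS u ltac:(lra)).
      eapply Rle_lt_trans; [right; apply f_equal; symmetry; apply (linear_minus (S u) _ _ Hlin)|].
      eapply Rle_lt_trans; [apply Hbound; lra|].
      apply Rlt_le_trans with (K * (eps / K)).
      + apply Rmult_lt_compat_l; [lra|]. apply Hlim. lra.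
      + right. field. lra. }
  exists (mkposreal delta Hdelta). intros r Hr Hr0.
  change (Rabs (r - s) < delta) in Hr. change (norm (minus (S r x) (S s x)) < eps).
  destruct (Rle_dec s r) as [Hsr|Hsr].
  - apply Hmod; [lra|]. rewrite Rabs_pos_eq in Hr; lra.
  - rewrite (norm_minus_sym (V := H)). apply Hmod; [lra|].
    rewrite Rabs_left in Hr; lra.
Qed.

(** [S s] commutes with the difference quotients that define the generator,
    and is continuous. *)
Lemma semigroup_domain {H : Hilbert} (A : LinearOperator H) (S : R -> H -> H) :
  generates A S -> forall x s, op_dom A x -> 0 <= s ->
  op_dom A (S s x) /\ A (S s x) = S s (A x).
Proof.
  intros [HS Hgen] x s Hx Hs. apply Hgen.
  assert (Hlin := semigroup_linear S HS s Hs).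
  apply (filterlim_ext_loc (fun h => S s (scal (/ h) (minus (S h x) x)))).
  - exists (mkposreal 1 Rlt_0_1). intros h _ Hh.
    eapply eq_trans; [apply (linear_scal (S s) Hlin)|]. apply f_equal.
    eapply eq_trans; [apply (linear_minus (S s) _ _ Hlin)|]. f_equal.
    rewrite <- !(semigroup_plus S HS) by lra. f_equal. ring.
  - eapply filterlim_comp; [apply (proj1 (Hgen x (A x))); now split|].
    exact (linear_cont (U := H) (V := H) (S s) _ Hlin).
Qed.

(** [S (r + h) x] is compared with the implicit rather than the explicit Euler
    step because dissipativity makes the implicit one a contraction exactly,
    without second order terms in [h]. *)
Lemma semigroup_contraction_on_domain {H : Hilbert} (A : LinearOperator H)
    (S : R -> H -> H) (K : R) :
  dissipative A -> generates A S -> 0 < K ->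
  (forall s x, 0 <= s -> norm (S s x) <= K * norm x) ->
  forall x s, op_dom A x -> 0 <= s -> norm (S s x) <= norm x.
Proof.
  intros HA HG HK Hbound x s Hx Hs. destruct (HG) as [HS Hgen].
  destruct (Req_dec s 0) as [->|Hs0]; [rewrite (semigroup_0 S HS); lra|].
  apply le_epsilon. intros eta Heta.
  (* Each step of length [h] will cost at most [h * (2 * K * eps)], and the
     steps add up to [s]. *)
  set (eps := eta / (2 * K * s)).
  assert (Heps : 0 < eps).
  { apply Rdiv_lt_0_compat; [lra|]. repeat apply Rmult_lt_0_compat; lra. }
  destruct (proj1 (filterlim_at_right_0_norm (V := H) _ _)
    (proj1 (Hgen x (A x)) (conj Hx eq_refl)) eps Heps) as [d1 [Hd1 Hlim1]].
  destruct (proj1 (filterlim_at_right_0_norm (V := H) _ _)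
    (semigroup_cont S HS (A x)) eps Heps) as [d2 [Hd2 Hlim2]].
  assert (Hstep : forall r h, 0 <= r -> 0 < h < d1 -> h < d2 ->
    norm (S (r + h) x) <= norm (S r x) + h * (2 * K * eps)).
  { intros r h Hr Hh1 Hh2.
    destruct (semigroup_domain A S HG x (r + h) Hx ltac:(lra)) as [Hdom HAz].
    assert (Hlin := semigroup_linear S HS r Hr).
    eapply Rle_trans; [apply (norm_le_minus_scal h _ (A (S (r + h) x)));
      [lra|now apply HA]|].
    rewrite HAz, !(semigroup_plus S HS) by lra.
    (* The consistency error is [S r (h * e)]: the difference quotient of the
       orbit at 0 and [S h (A x)] both tend to [A x]. *)
    set (e := minus (scal (/ h) (minus (S h x) x)) (S h (A x)) : H).
    assert (He : norm e <= 2 * eps).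
    { eapply Rle_trans; [apply (norm_minus_triangle (V := H) _ _ (A x))|].
      replace (2 * eps) with (eps + eps) by ring.
      left. apply Rplus_lt_compat; [apply Hlim1|apply Hlim2]; lra. }
    assert (Hsplit : minus (S r (S h x)) (scal h (S r (S h (A x))))
      = plus (S r x) (S r (scal h e))).
    { eapply eq_trans; [|apply (linear_plus (S r) Hlin)].
      eapply eq_trans;
        [|apply f_equal, f_equal; symmetry; apply (scal_minus_scal_inv (V := H)); lra].
      eapply eq_trans; [|apply f_equal; symmetry; apply (plus_minus_minus (G := H))].
      rewrite (linear_minus (S r) _ _ Hlin), (linear_scal (S r) Hlin). reflexivity. }
    rewrite Hsplit. eapply Rle_trans; [apply (norm_triangle (V := H))|].
    apply Rplus_le_compat_l. eapply Rle_trans; [now apply Hbound|].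
    replace (h * (2 * K * eps)) with (K * (h * (2 * eps))) by ring.
    apply Rmult_le_compat_l; [lra|].
    eapply Rle_trans; [apply (norm_scal_le (V := H)); lra|].
    apply Rmult_le_compat_l; lra. }
  assert (Hmin : 0 < Rmin d1 d2) by (apply Rmin_pos; lra).
  destruct (nfloor_ex (s / Rmin d1 d2)) as [m Hm].
  { left. apply Rdiv_lt_0_compat; lra. }
  set (h := s / (INR m + 1)).
  assert (Hm1 : 0 < INR m + 1) by (pose proof (pos_INR m); lra).
  assert (Hh : 0 < h) by (apply Rdiv_lt_0_compat; lra).
  assert (Hhmin : h < Rmin d1 d2).
  { unfold h. apply Rlt_div_l; [lra|]. rewrite Rmult_comm.
    apply Rlt_div_l; [lra|]. apply Hm. }
  assert (Hiter : forall n, norm (S (INR n * h) x) <= norm x + INR n * h * (2 * K * eps)).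
  { induction n as [|n IH].
    - simpl INR. rewrite !Rmult_0_l, Rplus_0_r, (semigroup_0 S HS). lra.
    - rewrite S_INR. replace ((INR n + 1) * h) with (INR n * h + h) by ring.
      pose proof (Rmin_l d1 d2). pose proof (Rmin_r d1 d2).
      assert (0 <= INR n * h) by (apply Rmult_le_pos; [apply pos_INR|lra]).
      pose proof (Hstep (INR n * h) h ltac:(lra) ltac:(lra) ltac:(lra)). lra. }
  specialize (Hiter (Datatypes.S m)). rewrite S_INR in Hiter.
  replace ((INR m + 1) * h) with s in Hiter by (unfold h; field; lra).
  replace (s * (2 * K * eps)) with eta in Hiter; [exact Hiter|].
  unfold eps. field. lra.
Qed.

(** The averages [(1 / h) * RInt (fun s => S s x) 0 h] lie in the domain and
    tend to [x] with [h].  They lie in the domain because [S k] shifts the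
    interval of integration, which leaves a difference of two quotients
    of the primitive [G], at [h] and at 0. *)
Lemma generator_domain_dense {H : Hilbert} (A : LinearOperator H)
    (S : R -> H -> H) (K : R) :
  generates A S -> 0 < K ->
  (forall s x, 0 <= s -> norm (S s x) <= K * norm x) ->
  forall (x : H) eps, 0 < eps ->
  exists z, op_dom A z /\ norm (minus z x) < eps.
Proof.
  intros [HS Hgen] HK Hbound x eps Heps.
  set (f := fun s => S (Rmax 0 s) x).
  assert (Hf : forall s, continuous f s).
  { apply (continuous_on_half_line_extension (fun s => S s x)).
    now apply semigroup_continuous_on with K. }
  assert (Hint : forall a b, is_RInt f a b (RInt f a b)).
  { intros a b. apply (RInt_correct (V := H)), (ex_RInt_continuous (V := H)).
    intros; apply Hf. }
  set (G := fun h => RInt f 0 h : H).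
  assert (HG : forall h, is_derive G h (f h)).
  { intros h. apply (is_derive_RInt (V := H) f G 0 h); [|apply Hf].
    apply filter_forall. intros b. apply Hint. }
  assert (HG0 : G 0 = zero) by exact (RInt_point (V := H) 0 f).
  assert (Hf0 : f 0 = x) by (unfold f; rewrite Rmax_left by lra; apply semigroup_0, HS).
  assert (Hshift : forall h k, 0 < h -> 0 < k ->
    S k (G h) = minus (G (h + k)) (G k)).
  { intros h k Hh Hk.
    assert (H1 : is_RInt f k (h + k) (S k (G h))).
    { apply (is_RInt_ext (V := H)
        (fun s => scal 1 (S k (f (1 * s + - k))) : H)).
      - intros s. rewrite Rmin_left, Rmax_right by lra. intros Hs.
        eapply eq_trans; [exact (scal_one (V := H) _)|]. unfold f.
        rewrite !Rmax_right, <- (semigroup_plus S HS) by lra. f_equal. ring.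
      - apply (is_RInt_comp_lin (V := H) (fun s => S k (f s)) 1 (- k)).
        replace (1 * k + - k) with 0 by ring. replace (1 * (h + k) + - k) with h by ring.
        apply (is_RInt_linear (U := H) (V := H) (S k)); [|apply Hint].
        apply (semigroup_linear S HS). lra. }
    assert (H2 : G (h + k) = plus (G k) (S k (G h)) :> H).
    { apply (is_RInt_unique (V := H)).
      exact (is_RInt_Chasles (V := H) f 0 k (h + k) _ _ (Hint 0 k) H1). }
    rewrite H2. symmetry. apply (minus_plus_cancel (G := H)). }
  assert (Hdom : forall h, 0 < h -> op_dom A (G h)).
  { intros h Hh. apply (Hgen (G h) (minus (f h) (f 0))).
    apply (filterlim_ext_loc (fun k => minus
      (scal (/ k) (minus (G (h + k)) (G h))) (scal (/ k) (minus (G (0 + k)) (G 0))))).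
    - exists (mkposreal 1 Rlt_0_1). intros k _ Hk. rewrite (Hshift h k Hh Hk).
      rewrite HG0, Rplus_0_l.
      eapply eq_trans; [symmetry; apply (scal_minus_distr_l (V := H))|]. apply f_equal.
      eapply eq_trans; [apply f_equal, (minus_zero_r (G := H))|]. apply (minus_minus_comm (G := H)).
    - apply (filterlim_minus (V := H)); apply (filterlim_right_quotient (V := H)), HG. }
  destruct (proj1 (filterlim_at_right_0_norm (V := H) _ _)
    (filterlim_right_quotient (V := H) G 0 _ (HG 0)) eps Heps) as [delta [Hdelta Hlim]].
  exists (scal (/ (delta / 2)) (G (delta / 2))). split.
  - apply op_dom_scal, Hdom. lra.
  - specialize (Hlim (delta / 2) ltac:(lra)). rewrite HG0, Hf0, Rplus_0_l in Hlim.
    eapply Rle_lt_trans; [right|exact Hlim]. do 3 f_equal. symmetry.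
    apply (minus_zero_r (G := H)).
Qed.

Lemma dissipative_semigroup_contraction {H : Hilbert} (A : LinearOperator H)
    (S : R -> H -> H) (K : R) :
  dissipative A -> generates A S -> 0 < K ->
  (forall s x, 0 <= s -> norm (S s x) <= K * norm x) ->
  forall x s, 0 <= s -> norm (S s x) <= norm x.
Proof.
  intros HA HG HK Hbound x s Hs. apply le_epsilon. intros eta Heta.
  assert (Heps : 0 < eta / (1 + K)) by (apply Rdiv_lt_0_compat; lra).
  destruct (generator_domain_dense A S K HG HK Hbound x _ Heps) as [z [Hz Hzx]].
  assert (Hlin := semigroup_linear S (proj1 HG) s Hs).
  assert (H1 : norm (S s x) <= norm (S s z) + norm (minus (S s x) (S s z)))
    by exact (norm_le_plus_minus (V := H) _ _).
  assert (H2 : norm z <= norm x + norm (minus z x))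
    by exact (norm_le_plus_minus (V := H) _ _).
  pose proof (semigroup_contraction_on_domain A S K HA HG HK Hbound z s Hz Hs) as H3.
  assert (H4 : norm (minus (S s x) (S s z)) <= K * norm (minus z x)).
  { eapply Rle_trans;
      [right; apply f_equal; symmetry; apply (linear_minus (S s) _ _ Hlin)|].
    eapply Rle_trans; [now apply Hbound|].
    right. apply f_equal, (norm_minus_sym (V := H)). }
  assert (H5 : K * norm (minus z x) <= K * (eta / (1 + K)))
    by (apply Rmult_le_compat_l; lra).
  assert (H6 : K * (eta / (1 + K)) + eta / (1 + K) = eta) by (field; lra).
  lra.
Qed.

(** * Mild solutions *)

Lemma mild_solution_initial {H : Hilbert} (S B : R -> H -> H) (U0 : H) (U : R -> H) :
  is_C0_semigroup S -> mild_solution S B U0 U -> U 0 = U0.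
Proof.
  intros HS [_ HU]. destruct (HU 0 (Rle_refl 0)) as [I [HI ->]].
  rewrite (semigroup_0 S HS).
  assert (HI0 : I = zero).
  { rewrite <- (is_RInt_unique (V := H) _ _ _ _ HI). apply (RInt_point (V := H)). }
  rewrite HI0. exact (plus_zero_r (G := H) U0).
Qed.

(** [S (s - r)] maps the integral over [0, r] in the formula for [U r] to the
    part over [0, r] of the integral in the formula for [U s]. *)
Lemma mild_solution_restart {H : Hilbert} (S B : R -> H -> H) (U0 : H)
    (U : R -> H) :
  is_C0_semigroup S -> mild_solution S B U0 U ->
  forall r s, 0 <= r <= s -> exists J : H,
    is_RInt (fun q => S (s - q) (B q (U q))) r s J /\
    U s = plus (S (s - r) (U r)) J.
Proof.
  intros HS [_ HU] r s Hrs.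
  destruct (HU r ltac:(lra)) as [Ir [HIr HUr]].
  destruct (HU s ltac:(lra)) as [Is [HIs HUs]].
  assert (Hlin := semigroup_linear S HS (s - r) ltac:(lra)).
  assert (Hhead : is_RInt (fun q => S (s - q) (B q (U q))) 0 r (S (s - r) Ir)).
  { apply (is_RInt_ext (V := H) (fun q => S (s - r) (S (r - q) (B q (U q))))).
    - intros q. rewrite Rmin_left, Rmax_right by lra. intros Hq.
      rewrite <- (semigroup_plus S HS) by lra. f_equal. ring.
    - now apply (is_RInt_linear (U := H) (V := H) (S (s - r))). }
  destruct (ex_RInt_Chasles_2 (V := H) (fun q => S (s - q) (B q (U q))) 0 r s Hrs)
    as [J HJ]; [now exists Is|].
  exists J. split; [exact HJ|].
  assert (HI : Is = plus (S (s - r) Ir) J).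
  { rewrite <- (is_RInt_unique (V := H) _ _ _ _ HIs). apply (is_RInt_unique (V := H)).
    exact (is_RInt_Chasles (V := H) _ 0 r s _ _ Hhead HJ). }
  rewrite HUs, HUr, HI.
  eapply eq_trans; [exact (plus_assoc (G := H) _ _ _)|]. f_equal.
  eapply eq_trans; [|symmetry; apply (linear_plus (S (s - r)) Hlin)]. f_equal.
  rewrite <- (semigroup_plus S HS) by lra. f_equal. ring.
Qed.

Lemma mild_solution_free {H : Hilbert} (S B : R -> H -> H) (U0 : H)
    (U : R -> H) (r s : R) :
  is_C0_semigroup S -> mild_solution S B U0 U -> 0 <= r <= s ->
  (forall q x, r < q < s -> B q x = zero) ->
  U s = S (s - r) (U r).
Proof.
  intros HS HU Hrs HB.
  destruct (mild_solution_restart S B U0 U HS HU r s Hrs) as [J [HJ ->]].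
  assert (HJ0 : J = zero).
  { rewrite <- (is_RInt_unique (V := H) _ _ _ _ HJ). apply (is_RInt_unique (V := H)).
    apply (is_RInt_ext (V := H) (fun _ => zero)).
    - intros q. rewrite Rmin_left, Rmax_right by lra. intros Hq.
      rewrite HB by lra. symmetry.
      exact (linear_zero (S (s - q)) (semigroup_linear S HS (s - q) ltac:(lra))).
    - assert (H0 := is_RInt_const (V := H) r s zero).
      rewrite (scal_zero_r (V := H)) in H0. exact H0. }
  rewrite HJ0. exact (plus_zero_r (G := H) _).
Qed.

(** The bound on [B] is asked on the closed interval, where the comparison of
    integrals needs it. *)
Lemma mild_solution_growth {H : Hilbert} (S B : R -> H -> H) (U0 : H)
    (U : R -> H) (r s k : R) :
  is_C0_semigroup S -> (forall q x, 0 <= q -> norm (S q x) <= norm x) ->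
  mild_solution S B U0 U -> 0 <= r <= s -> 0 <= k ->
  (forall q x, r <= q <= s -> norm (B q x) <= k * norm x) ->
  norm (U s) <= norm (U r) * exp (k * (s - r)).
Proof.
  intros HS Hcontr HU Hrs Hk HB.
  set (phi := fun q => norm (U (Rmax 0 q))).
  assert (Hphi : forall q, continuous phi q).
  { intros q. unfold phi.
    apply (continuous_comp (fun q => U (Rmax 0 q)) norm).
    - apply (continuous_on_half_line_extension (V := H) U (proj1 HU)).
    - apply (filterlim_norm (V := H)). }
  assert (HphiU : forall q, 0 <= q -> phi q = norm (U q)).
  { intros q Hq. unfold phi. now rewrite Rmax_right. }
  assert (Hint : forall q, is_RInt phi r q (RInt phi r q)).
  { intros q. apply (RInt_correct (V := R_CompleteNormedModule)).
    apply (ex_RInt_continuous (V := R_CompleteNormedModule)). intros; apply Hphi. }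
  rewrite <- (HphiU s) by lra. apply (gronwall phi r s); [exact Hk|exact Hphi| |lra].
  intros q Hq. rewrite HphiU by lra.
  destruct (mild_solution_restart S B U0 U HS HU r q ltac:(lra)) as [J [HJ ->]].
  eapply Rle_trans; [apply (norm_triangle (V := H))|].
  apply Rplus_le_compat; [apply Hcontr; lra|].
  apply (norm_RInt_le (V := H) (fun p => S (q - p) (B p (U p)))
    (fun p => k * phi p) r q); [lra| |exact HJ|].
  - intros p Hp. rewrite HphiU by lra.
    eapply Rle_trans; [apply Hcontr; lra|]. apply HB. lra.
  - exact (is_RInt_scal (V := R_NormedModule) phi r q k _ (Hint q)).
Qed.

(** * Exponential decay *)

Lemma exp_le_compat (a b : R) : a <= b -> exp a <= exp b.
Proof.
  intros [Hlt| ->]; [left; now apply exp_increasing|lra].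
Qed.

Lemma geometric_le_exponential (d P s : R) (m : nat) :
  0 < d < 1 -> 0 < P -> s <= INR m * P -> d ^ m <= exp (- (- ln d / P) * s).
Proof.
  intros Hd HP Hs. rewrite <- Rpower_pow by lra. unfold Rpower.
  assert (Hln : ln d < 0) by (rewrite <- ln_1; apply ln_increasing; lra).
  replace (INR m * ln d) with (- (- ln d / P) * (INR m * P)) by (field; lra).
  assert (0 <= - ln d / P * (INR m * P - s)).
  { apply Rmult_le_pos; [|lra]. left. apply Rdiv_lt_0_compat; lra. }
  assert (Hle : - (- ln d / P) * (INR m * P) <= - (- ln d / P) * s) by lra.
  now apply exp_le_compat.
Qed.

Theorem theorem5p4 (H : Hilbert) (A : LinearOperator H) (S : R -> H -> H)
    (M mu : R) (t : nat -> R) (D : nat -> H -> H) (B : R -> H -> H)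
    (T0 Tt d : R)
    (A_dissipative : dissipative A)
    (A_generates : generates A S)
    (M_pos : 0 < M) (mu_pos : 0 < mu)
    (S_decay : forall s, 0 <= s -> op_norm (S s) <= M * exp (- mu * s))
    (t_0 : t 0%nat = 0)
    (t_incr : forall n, t n < t (n + 1)%nat)
    (D_bounded : forall n, is_linear (D (2 * n + 1)%nat))
    (B_even : forall n s x,
      t (2 * n)%nat <= s < t (2 * n + 1)%nat -> B s x = zero)
    (B_odd : forall n s x,
      t (2 * n + 1)%nat <= s < t (2 * n + 2)%nat -> B s x = D (2 * n + 1)%nat x)
    (B_antidamping : forall s V, 0 < s -> 0 <= inner (B s V) V)
    (T_even : forall n, t (2 * n + 1)%nat - t (2 * n)%nat = T0)
    (T0_large : / mu * ln M < T0)
    (T_odd : forall n, t (2 * n + 2)%nat - t (2 * n + 1)%nat = Tt)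
    (d_sup : is_lub
      (fun r => exists n : nat,
        r = exp (2 * op_norm (D (2 * n + 1)%nat) * Tt) * (M * exp (- mu * T0)))
      d)
    (d_lt_1 : d < 1) :
  exists C alpha : R, 0 < C /\ 0 < alpha /\
    forall (U0 : H) (U : R -> H), mild_solution S B U0 U ->
      forall s, 0 < s -> norm (U s) <= C * exp (- alpha * s) * norm U0.
Proof.
  assert (HS := proj1 A_generates).
  assert (HT0 : 0 < T0) by (pose proof (T_even 0%nat); pose proof (t_incr (2 * 0)%nat); lra).
  assert (HTt : 0 < Tt).
  { pose proof (T_odd 0%nat) as H1. pose proof (t_incr (2 * 0 + 1)%nat) as H2.
    simpl in H1, H2. lra. }
  assert (Hdecay : forall s x, 0 <= s -> norm (S s x) <= M * exp (- mu * s) * norm x).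
  { intros s x Hs.
    eapply Rle_trans; [apply (norm_le_op_norm (S s)), (semigroup_linear S HS s Hs)|].
    apply Rmult_le_compat_r; [apply (norm_ge_0 (V := H))|now apply S_decay]. }
  assert (Hcontr : forall x s, 0 <= s -> norm (S s x) <= norm x).
  { apply (dissipative_semigroup_contraction A S M); try assumption.
    intros s x Hs. eapply Rle_trans; [now apply Hdecay|].
    apply Rmult_le_compat_r; [apply (norm_ge_0 (V := H))|].
    rewrite <- (Rmult_1_r M) at 2. apply Rmult_le_compat_l; [lra|].
    rewrite <- exp_0. assert (0 <= mu * s) by (apply Rmult_le_pos; lra).
    apply exp_le_compat. lra. }
  set (c := M * exp (- mu * T0)) in *.
  assert (Hc : 0 < c) by (apply Rmult_lt_0_compat; [lra|apply exp_pos]).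
  set (k := fun n => op_norm (D (2 * n + 1)%nat)) in *.
  assert (Hk : forall n, 0 <= k n) by (intros n; apply op_norm_ge_0, D_bounded).
  assert (Hfactor : forall n, exp (k n * Tt) * c <= d).
  { intros n. apply Rle_trans with (exp (2 * k n * Tt) * c).
    - apply Rmult_le_compat_r; [lra|].
      assert (0 <= k n * Tt) by (apply Rmult_le_pos; [apply Hk|lra]).
      apply exp_le_compat. lra.
    - apply (proj1 d_sup). now exists n. }
  assert (Hd : 0 < d).
  { eapply Rlt_le_trans; [|apply (Hfactor 0%nat)].
    apply Rmult_lt_0_compat; [apply exp_pos|lra]. }
  assert (Ht : forall n, t (2 * n)%nat = INR n * (T0 + Tt)).
  { induction n as [|n IH]; [simpl; rewrite t_0; ring|].
    rewrite S_INR. replace (2 * Datatypes.S n)%nat with (2 * n + 2)%nat by lia.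
    pose proof (T_even n). pose proof (T_odd n). lra. }
  assert (Ht_ge : forall n, 0 <= t (2 * n)%nat).
  { intros n. rewrite Ht. apply Rmult_le_pos; [apply pos_INR|lra]. }
  (* Before time [(n + 1) * (T0 + Tt)] the norm is at most
     [(d / c) * d ^ n = d ^ (n + 1) / c] times that of [U0], and [d ^ (n + 1)]
     is the value of [exp (- alpha * s)] at that time. *)
  exists (/ c), (- ln d / (T0 + Tt)).
  split; [now apply Rinv_0_lt_compat|]. split.
  { pose proof (ln_increasing d 1 Hd d_lt_1) as Hln. rewrite ln_1 in Hln.
    apply Rdiv_lt_0_compat; lra. }
  intros U0 U HU s Hs.
  assert (Heven : forall n q, t (2 * n)%nat <= q <= t (2 * n + 1)%nat ->
    U q = S (q - t (2 * n)%nat) (U (t (2 * n)%nat))).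
  { intros n q Hq. apply (mild_solution_free S B U0); try assumption.
    - split; [apply Ht_ge|apply Hq].
    - intros p x Hp. apply (B_even n). lra. }
  assert (Hodd : forall n q, t (2 * n + 1)%nat <= q <= t (2 * n + 2)%nat ->
    norm (U q) <= norm (U (t (2 * n + 1)%nat)) * exp (k n * Tt)).
  { intros n q Hq. pose proof (T_even n). pose proof (T_odd n). pose proof (Ht_ge n).
    eapply Rle_trans.
    - apply (mild_solution_growth S B U0 U (t (2 * n + 1)%nat) q (k n)); try assumption.
      + intros; now apply Hcontr.
      + lra.
      + apply Hk.
      (* At the right endpoint, [B] already has its value zero of the next
         interval. *)
      + intros p x Hp. destruct (Req_dec p (t (2 * n + 2)%nat)) as [Hend|Hend].
        * rewrite (B_even (n + 1)%nat).
          -- eapply Rle_trans; [right; apply (norm_zero (V := H))|].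
             apply Rmult_le_pos; [apply Hk|apply (norm_ge_0 (V := H))].
          -- replace (2 * (n + 1))%nat with (2 * n + 2)%nat by lia.
             pose proof (t_incr (2 * n + 2)%nat). lra.
        * rewrite (B_odd n) by lra.
          apply (norm_le_op_norm (D (2 * n + 1)%nat)), D_bounded.
    - apply Rmult_le_compat_l; [apply (norm_ge_0 (V := H))|].
      assert (0 <= k n * (Tt - (q - t (2 * n + 1)%nat)))
        by (apply Rmult_le_pos; [apply Hk|lra]).
      apply exp_le_compat. lra. }
  assert (Hperiods : forall n, norm (U (t (2 * n)%nat)) <= d ^ n * norm U0).
  { induction n as [|n IH].
    - simpl (2 * 0)%nat. rewrite t_0, (mild_solution_initial S B U0 U HS HU). simpl. lra.
    - pose proof (T_even n) as HTe. pose proof (T_odd n) as HTo.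
      replace (2 * Datatypes.S n)%nat with (2 * n + 2)%nat by lia.
      eapply Rle_trans; [apply (Hodd n); lra|].
      rewrite (Heven n (t (2 * n + 1)%nat)), HTe by lra.
      apply Rle_trans with (c * norm (U (t (2 * n)%nat)) * exp (k n * Tt)).
      + apply Rmult_le_compat_r; [left; apply exp_pos|]. apply Hdecay. lra.
      + replace (c * norm (U (t (2 * n)%nat)) * exp (k n * Tt))
          with (exp (k n * Tt) * c * norm (U (t (2 * n)%nat))) by ring.
        replace (d ^ Datatypes.S n * norm U0) with (d * (d ^ n * norm U0))
          by (simpl; ring).
        apply Rmult_le_compat; [|apply (norm_ge_0 (V := H))|apply Hfactor|exact IH].
        apply Rmult_le_pos; [left; apply exp_pos|lra]. }
  destruct (nfloor_ex (s / (T0 + Tt))) as [n [Hn1 Hn2]].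
  { left. apply Rdiv_lt_0_compat; lra. }
  apply Rle_div_r in Hn1; [|lra]. apply Rlt_div_l in Hn2; [|lra].
  pose proof (Ht n) as Htn. pose proof (T_even n) as HTe. pose proof (T_odd n) as HTo.
  assert (Hn : norm (U s) <= / c * d * norm (U (t (2 * n)%nat))).
  { assert (Hgrow : exp (k n * Tt) <= / c * d).
    { replace (exp (k n * Tt)) with (/ c * (exp (k n * Tt) * c)) by (field; lra).
      apply Rmult_le_compat_l; [left; now apply Rinv_0_lt_compat|apply Hfactor]. }
    assert (Hfree : forall q, t (2 * n)%nat <= q <= t (2 * n + 1)%nat ->
      norm (U q) <= norm (U (t (2 * n)%nat))).
    { intros q Hq. rewrite (Heven n q Hq). apply Hcontr. lra. }
    apply Rle_trans with (norm (U (t (2 * n)%nat)) * exp (k n * Tt)).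
    - destruct (Rle_dec s (t (2 * n + 1)%nat)) as [Hle|Hgt].
      + eapply Rle_trans; [apply Hfree; lra|].
        rewrite <- (Rmult_1_r (norm _)) at 1.
        apply Rmult_le_compat_l; [apply (norm_ge_0 (V := H))|].
        assert (0 <= k n * Tt) by (apply Rmult_le_pos; [apply Hk|lra]).
        pose proof (exp_ineq1_le (k n * Tt)). lra.
      + eapply Rle_trans; [apply (Hodd n); lra|].
        apply Rmult_le_compat_r; [left; apply exp_pos|]. apply Hfree. lra.
    - rewrite Rmult_comm. apply Rmult_le_compat_r; [apply (norm_ge_0 (V := H))|].
      exact Hgrow. }
  assert (Hexp := geometric_le_exponential d (T0 + Tt) s (Datatypes.S n)
    ltac:(lra) ltac:(lra) ltac:(rewrite S_INR; lra)).
  assert (Hci : 0 < / c) by now apply Rinv_0_lt_compat.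
  eapply Rle_trans; [exact Hn|].
  apply Rle_trans with (/ c * d * (d ^ n * norm U0)).
  - apply Rmult_le_compat_l; [|apply Hperiods]. apply Rmult_le_pos; lra.
  - replace (/ c * d * (d ^ n * norm U0)) with (/ c * d ^ Datatypes.S n * norm U0)
      by (simpl; ring).
    apply Rmult_le_compat_r; [apply (norm_ge_0 (V := H))|].
    apply Rmult_le_compat_l; [lra|exact Hexp].
Qed.
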